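(* For every positive integer $n$, the number of index stable $2$-element subsets of $\mathbb{Z}_n$ equals $$\sum_{\substack{m\in\{2,3,4,5,7\}\\ m\mid n}}\frac{n\,\varphi(m)}{2}=\frac n2\Bigl(\mathbf{1}_{2\mid n}+2\,\mathbf{1}_{3\mid n}+2\,\mathbf{1}_{4\mid n}+4\,\mathbf{1}_{5\mid n}+6\,\mathbf{1}_{7\mid n}\Bigr).$$
   Context: $\mathbb{Z}_n=\{0,1,\ldots,n-1\}$ is the group of least nonnegative residues modulo $n$ under addition modulo $n$; sums and differences of elements and subsets are taken in this group, so $A-A=\{a-a' : a,a'\in A\}$, etc. Let $A$ be a non-empty subset of $\mathbb{Z}_n$. A subset $B\subseteq\mathbb{Z}_n$ is called a subfactor of $\mathbb{Z}_n$ relative to $A$ if $(A-A)\cap(B-B)=\{0\}$ and $(A-A)+B=\mathbb{Z}_n$. The lower subindex $|\mathbb{Z}_n:A|^-$ (resp. upper subindex $|\mathbb{Z}_n:A|^+$) is the minimum (resp. maximum) of $|B|$ over all subfactors $B$ of $\mathbb{Z}_n$ relative to $A$. The set $A$ is called index stable (in $\mathbb{Z}_n$) if $|\mathbb{Z}_n:A|^-=|\mathbb{Z}_n:A|^+$. Here $\varphi$ is Euler's totient function and $\mathbf{1}_{q\mid n}$ is $1$ if $q$ divides $n$ and $0$ otherwise. *)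

(* Defs.v *)
From HB Require Import structures.
From mathcomp Require Import all_boot all_order all_algebra.
Set Implicit Arguments.
Unset Strict Implicit.
Unset Printing Implicit Defensive.
Import GRing.Theory.
Local Open Scope ring_scope.

Section Subfactors.
Variable G : finZmodType.
Implicit Types A B : {set G}.

Definition sumset A B : {set G} := [set a + b | a in A, b in B].
Definition diffset A B : {set G} := [set a - b | a in A, b in B].

Definition subfactor A B : bool :=
  (diffset A A :&: diffset B B == [set 0]) &&
  (sumset (diffset A A) B == [set: G]).

(* #|G| bounds every #|B|, so the default value never affects the minimum;
   [subfactor_exists] shows that for nonempty A the minimum and the maximum
   range over a nonempty family. *)
Definition lower_subindex A : nat :=
  \big[minn/#|G|]_(B : {set G} | subfactor A B) #|B|.
Definition upper_subindex A : nat :=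
  \max_(B : {set G} | subfactor A B) #|B|.

Definition index_stable A : bool :=
  (A != set0) && (lower_subindex A == upper_subindex A).

Lemma mem_diffset A B x y : x \in A -> y \in B -> x - y \in diffset A B.
Proof. by move=> xA yB; apply/imset2P; exists x y. Qed.

Lemma diffsetN A x : x \in diffset A A -> - x \in diffset A A.
Proof. by case/imset2P=> a b aA bA ->; rewrite opprB mem_diffset. Qed.

Lemma subfactor_exists A : A != set0 -> exists B, subfactor A B.
Proof.
case/set0Pn=> a aA.
have D0 : 0 \in diffset A A by rewrite -(subrr a) mem_diffset.
pose indep B := diffset A A :&: diffset B B == [set 0].
have indep1 : indep [set 0].
  apply/eqP/setP=> x; rewrite !inE; apply/andP/eqP => [[_]|->].
    by case/imset2P=> u v /set1P-> /set1P-> ->; rewrite subrr.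
  by split=> //; apply/imset2P; exists 0 0; rewrite ?inE ?subrr.
have [B /maxsetP[/eqP indB maxB] _] := maxset_exists indep1.
exists B; rewrite /subfactor indB eqxx /=.
apply/eqP/setP=> x; rewrite inE; apply: contraT => xN.
have xD b : b \in B -> x - b \notin diffset A A.
  move=> bB; apply: contra xN => xb; apply/imset2P.
  by exists (x - b) b => //; rewrite subrK.
have xB : x \notin B by apply/negP => /xD; rewrite subrr D0.
have /maxB/(_ (subsetUr _ _)) xUB : indep (x |: B); last first.
  by rewrite -xUB setU11 in xB.
apply/eqP/setP=> y; rewrite !inE; apply/andP/eqP => [[yD]|->]; last first.
  by split=> //; rewrite -(subrr x) mem_diffset ?setU11.
case/imset2P=> u v /setU1P[->|uB] /setU1P[->|vB] yE.
- by rewrite yE subrr.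
- by move: yD; rewrite yE (negbTE (xD _ vB)).
- by move/diffsetN: yD; rewrite yE opprB (negbTE (xD _ uB)).
- by apply/set1P; rewrite -indB inE yD yE mem_diffset.
Qed.

Lemma lower_subindexP A : A != set0 ->
  (exists2 B, subfactor A B & #|B| = lower_subindex A) /\
  (forall B, subfactor A B -> (lower_subindex A <= #|B|)%N).
Proof.
move=> /subfactor_exists[B0 sB0].
case: (arg_minnP (fun B : {set G} => #|B|) sB0) => B sB Bmin.
suff -> : lower_subindex A = #|B| by split=> //; exists B.
apply/eqP; rewrite eqn_leq; apply/andP; split.
  rewrite /lower_subindex; elim: (index_enum _) (mem_index_enum B) => // C s IHs.
  rewrite big_cons inE => /predU1P[<-|/IHs leB]; first by rewrite sB geq_minl.
  by case: ifP => // _; apply: leq_trans (geq_minr _ _) leB.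
rewrite /lower_subindex; elim/big_ind: _ => [|m p Hm Hp|C /Bmin //].
  exact: max_card.
by rewrite leq_min Hm.
Qed.

Lemma upper_subindexP A : A != set0 ->
  (exists2 B, subfactor A B & #|B| = upper_subindex A) /\
  (forall B, subfactor A B -> (#|B| <= upper_subindex A)%N).
Proof.
move=> /subfactor_exists[B0 sB0]; split=> [|B sB].
  case: (arg_maxnP (fun B : {set G} => #|B|) sB0) => B sB Bmax.
  exists B => //; apply/eqP; rewrite eqn_leq (leq_bigmax_cond _ sB) /=.
  exact/bigmax_leqP.
exact: (leq_bigmax_cond _ sB).
Qed.

End Subfactors.

(* Main.v *)
Require Import Defs.
From HB Require Import structures.
From mathcomp Require Import all_boot all_order all_algebra.
From mathcomp Require Import fingroup cyclic zify ring.
Set Implicit Arguments.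
Unset Strict Implicit.
Unset Printing Implicit Defensive.
Import GRing.Theory.
Local Open Scope ring_scope.

(* For A = {a, a + d} with d of order m, the subfactors relative to A are the
   maximal independent sets of the Cayley graph generated by d, which is a
   disjoint union of m-cycles (of edges if m = 2).  If m is 2, 3, 4, 5 or 7,
   all maximal independent sets of an m-cycle have m./2 elements, so A is
   index stable.  If m = 6 or m >= 8, replacing the elements 2 and 4 of the
   maximal independent set {0, 2, 4, ...} by the single element 3 in every
   cycle gives a strictly smaller one.  It remains to count pairs (a, d), each
   2-element set arising from exactly two of them, and Z_n has totient m
   elements of order m for each divisor m of n. *)

(** * Subfactors relative to a pair as maximal independent sets *)

Lemma index_stableP (G : finZmodType) (A : {set G}) : A != set0 ->
  reflect (forall B C, subfactor A B -> subfactor A C -> #|B| = #|C|)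
          (index_stable A).
Proof.
move=> A0; rewrite /index_stable A0 /=.
apply: (iffP eqP) => [eq_idx B C sB sC|stab]; last first.
  have [[B sB <-] _] := lower_subindexP A0.
  by have [[C sC <-] _] := upper_subindexP A0; apply: stab.
have [_ lower] := lower_subindexP A0; have [_ upper] := upper_subindexP A0.
have card_eq X : subfactor A X -> #|X| = upper_subindex A.
  by move=> sX; apply/eqP; rewrite eqn_leq upper //= -eq_idx lower.
by rewrite !card_eq.
Qed.

Lemma diffset_pair (G : finZmodType) (a d : G) :
  diffset [set a; a + d] [set a; a + d] = [set 0; d; - d].
Proof.
apply/setP=> x; rewrite !inE; apply/imset2P/idP => [[u v]|].
  rewrite !inE => /orP[] /eqP-> /orP[] /eqP-> ->.
  - by rewrite subrr eqxx.
  - by rewrite opprD addNKr eqxx !orbT.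
  - by rewrite addrC addKr eqxx !orbT.
  - by rewrite subrr eqxx.
case/orP=> [/orP[]|] /eqP->.
- by exists a a; rewrite ?inE ?eqxx ?subrr.
- by exists (a + d) a; rewrite ?inE ?eqxx ?orbT // addrC addKr.
- by exists a (a + d); rewrite ?inE ?eqxx ?orbT // opprD addNKr.
Qed.

(* The second conjunct says that x + d lies in (A - A) + B. *)
Lemma subfactor_pairP (G : finZmodType) (a d : G) (B : {set G}) : d != 0 ->
  reflect
    (forall x, ~~ ((x \in B) && (x + d \in B))
            && [|| x \in B, x + d \in B | x + d + d \in B])
    (subfactor [set a; a + d] B).
Proof.
move=> d0; rewrite /subfactor diffset_pair.
apply: (iffP andP) => [[/eqP indB /eqP covB] x | maxB]; last first.
  have ind x : x \in B -> x + d \in B -> False.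
    by move=> xB xdB; have := maxB x; rewrite xB xdB.
  have cov x : exists2 u, u \in [set 0; d; - d] & x - u \in B.
    (* Based at [x - d], the three consecutive points are [x - d], [x], [x + d]. *)
    have /andP[_] := maxB (x - d); rewrite subrK => /or3P[] yB.
    - by exists d; rewrite ?inE ?eqxx ?orbT.
    - by exists 0; rewrite ?inE ?eqxx ?subr0.
    - by exists (- d); rewrite ?inE ?eqxx ?orbT ?opprK.
  split; apply/eqP/setP=> x; rewrite !inE; last first.
    have [u uD uB] := cov x.
    by apply/imset2P; exists u (x - u) => //; rewrite addrC subrK.
  apply/andP/eqP => [[]|->]; last first.
    have [u _ uB] := cov 0; rewrite eqxx; split=> //.
    by apply/imset2P; exists (0 - u) (0 - u); rewrite ?subrr.
  case/orP=> [/orP[]|] /eqP-> // /imset2P[u v uB vB] /eqP.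
    rewrite eq_sym subr_eq => /eqP uE.
    by case: (ind v vB); rewrite addrC -uE.
  rewrite eq_sym subr_eq addrC => /eqP uE.
  by case: (ind u uB); rewrite uE subrK.
apply/andP; split.
  apply/andP => -[xB xdB].
  have: d \in [set 0; d; - d] :&: diffset B B.
    rewrite !inE eqxx orbT; apply/imset2P; exists (x + d) x => //.
    by rewrite addrC addKr.
  by rewrite indB inE (negbTE d0).
have: x + d \in sumset [set 0; d; - d] B by rewrite covB inE.
case/imset2P=> u v; rewrite !inE => /orP[/orP[]|] /eqP-> vB xE.
- by rewrite xE add0r vB orbT.
- by move: xE; rewrite [d + v]addrC => /addIr->; rewrite vB.
- by rewrite xE addrAC addNr add0r vB !orbT.
Qed.

(** * Maximal independent sets of a single cycle *)

Section CyclePatterns.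
Local Open Scope nat_scope.

(** The condition looks only two places ahead, so periodicity at 0 and 1 closes the cycle and leaves
    a truth table in [m] booleans. *)
Lemma sum_maximal_independent_cycle (m : nat) (f : nat -> bool) :
    m \in [:: 2; 3; 4; 5; 7] -> (forall i, f (m + i) = f i) ->
    (forall i, ~~ (f i && f i.+1) && [|| f i, f i.+1 | f i.+2]) ->
  \sum_(i < m) f i = m./2.
Proof.
rewrite !inE => /or4P[|||/orP[]] /eqP-> per maxf;
  rewrite !big_ord_recr big_ord0 /=;
  move: (per 0) (per 1); rewrite addn0 addn1 => p0 p1;
  move: (maxf 0) (maxf 1) (maxf 2) (maxf 3) (maxf 4) (maxf 5) (maxf 6);
  rewrite ?p0 ?p1.
- by move=> + _ _ _ _ _ _; case: (f 0); case: (f 1).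
- by move=> + + + _ _ _ _; case: (f 0); case: (f 1); case: (f 2).
- move=> + + + + _ _ _.
  by case: (f 0); case: (f 1); case: (f 2); case: (f 3).
- move=> + + + + + _ _.
  by case: (f 0); case: (f 1); case: (f 2); case: (f 3); case: (f 4).
- by case: (f 0); case: (f 1); case: (f 2); case: (f 3); case: (f 4);
    case: (f 5); case: (f 6).
Qed.

Definition cycle_succ (m i : nat) : nat := if i.+1 < m then i.+1 else 0.

Definition maximal_independent_cycle (m : nat) (p : pred nat) : Prop :=
  forall i, i < m ->
    ~~ (p i && p (cycle_succ m i))
    && [|| p i, p (cycle_succ m i) | p (cycle_succ m (cycle_succ m i))].

(* The bound excludes i = m.-1, which is adjacent to 0 and even when m is odd. *)
Definition large_pattern (m : nat) : pred nat :=
  [pred i | ~~ odd i && (i.+1 < m)].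

Definition small_pattern (m : nat) : pred nat :=
  [pred i | (i == 3) || [&& large_pattern m i, i != 2 & i != 4]].

Lemma large_pattern_maximal (m : nat) : 5 < m ->
  maximal_independent_cycle m (large_pattern m).
Proof.
move=> m5 i im; rewrite /large_pattern /cycle_succ /=.
by do ![case: ifP => ?]; lia.
Qed.

(** The critical position is 5, which has lost its neighbour 4. It is next to 6, which is chosen
    when [m >= 8], or to 0 when [m = 6]; when [m = 7] neither neighbour is chosen. *)
Lemma small_pattern_maximal (m : nat) : 5 < m -> m != 7 ->
  maximal_independent_cycle m (small_pattern m).
Proof.
move=> m5 m7 i im; rewrite /small_pattern /large_pattern /cycle_succ /=.
by do ![case: ifP => ?]; lia.
Qed.

End CyclePatterns.

(** * Gluing the cycles: cosets of the subgroup generated by [d] *)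

Section PairSubfactors.
Variables (G : finZmodType) (d : G).
Let m := #[d]%g.

Lemma mulrn_eq0_order k : (d *+ k == 0) = (m %| k)%N.
Proof. by rewrite /m order_dvdn FinRing.zmodXgE FinRing.zmod1gE. Qed.

(** Double counting of the pairs [(x, i)] with [i < m] and [x + d *+ i] in [B]: each [i] contributes
    [#|B|] by translation, and each [x] contributes [m./2] by going once around its cycle. *)
Lemma card_subfactor_pair (a : G) (B : {set G}) :
    m \in [:: 2; 3; 4; 5; 7]%N -> subfactor [set a; a + d] B ->
  (#|B| * m = #|G| * m./2)%N.
Proof.
move=> m_small; have d0 : d != 0.
  by have := mulrn_eq0_order 1; rewrite mulr1n => ->;
    apply: contraL m_small; rewrite dvdn1 => /eqP->.
move/subfactor_pairP => /(_ d0) maxB.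
have dm : d *+ m = 0 by apply/eqP; rewrite mulrn_eq0_order.
have cnt x : (\sum_(i < m) ((x + d *+ i)%R \in B) = m./2)%N.
  apply: (@sum_maximal_independent_cycle m (fun i => x + d *+ i \in B)) => // i.
    by rewrite mulrnDr dm add0r.
  by have := maxB (x + d *+ i); rewrite !mulrSr !addrA.
transitivity (\sum_(i < m) \sum_(x : G) ((x + d *+ i)%R \in B))%N; last first.
  by rewrite exchange_big -sum_nat_const; apply: eq_bigr => x _; apply: cnt.
rewrite mulnC -[X in (X * _)%N](card_ord m) -sum_nat_const.
apply: eq_bigr => i _; rewrite (reindex_inj (addIr (- (d *+ i)))) /=.
by under eq_bigr do rewrite subrK; rewrite -sum1_card big_mkcond.
Qed.

Let f (x : G) := x + d.

Lemma iter_shift k x : iter k f x = x + d *+ k.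
Proof.
by elim: k => [|k IHk]; rewrite ?addr0 //= IHk /f mulrSr addrA.
Qed.

Lemma shift_inj : injective f. Proof. exact: addIr. Qed.

Lemma order_shift x : fingraph.order f x = m.
Proof.
have: (m %| fingraph.order f x)%N.
  rewrite -mulrn_eq0_order -(inj_eq (addrI x)) addr0 -iter_shift.
  by rewrite (iter_order shift_inj).
move/dvdn_leq => /(_ (fingraph.order_gt0 f x)) ge_m.
(* On an orbit longer than [m], the [m]-th iterate would have index [m]; but it is [x] itself, of
   index 0. *)
apply/eqP; rewrite eqn_leq ge_m andbT leqNgt; apply/negP => /findex_iter.
rewrite iter_shift; have /eqP-> : d *+ m == 0 by rewrite mulrn_eq0_order.
by rewrite addr0 findex0 => m0; have := order_gt0 d; rewrite -/m -m0.
Qed.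

(* The position of x in its coset of <d>, counted from a chosen base point. *)
Definition coset_index (x : G) : nat := findex f (froot f x) x.

Lemma froot_connect x : fconnect f (froot f x) x.
Proof. by rewrite (fconnect_sym shift_inj) connect_root. Qed.

Lemma coset_index_lt x : (coset_index x < m)%N.
Proof. by rewrite -(order_shift (froot f x)) findex_max ?froot_connect. Qed.

Lemma froot_iter k x : froot f (iter k f x) = froot f x.
Proof.
apply/esym/eqP; rewrite (root_connect (fconnect_sym shift_inj)).
exact: fconnect_iter.
Qed.

Lemma coset_index_shift x : coset_index (x + d) = cycle_succ m (coset_index x).
Proof.
rewrite {1}/coset_index (froot_iter 1) /cycle_succ.
have -> : x + d = iter (coset_index x).+1 f (froot f x).
  by rewrite iterS iter_findex ?froot_connect.
have := coset_index_lt x; rewrite leq_eqVlt; case: ltnP => [ltm _|].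
  by rewrite findex_iter // order_shift.
move=> _ /orP[/eqP->|] //.
by rewrite -(order_shift (froot f x)) (iter_order shift_inj) findex0.
Qed.

Lemma coset_index_surj i : (i < m)%N -> exists x, coset_index x = i.
Proof.
move=> lti; exists (iter i f (froot f 0)).
rewrite /coset_index froot_iter (root_root (fconnect_sym shift_inj)).
by rewrite findex_iter ?order_shift.
Qed.

Lemma subfactor_of_pattern (a : G) (p : pred nat) : d != 0 ->
  maximal_independent_cycle m p ->
  subfactor [set a; a + d] [set x | p (coset_index x)].
Proof.
move=> d0 maxp; apply/(subfactor_pairP _ _ d0) => x.
by rewrite !inE !coset_index_shift maxp ?coset_index_lt.
Qed.

(** Moving each element at position 3 to position 4 embeds the small set into the large one,
    injectively because the small pattern omits 4. The image misses position 2. *)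
Lemma card_small_pattern : (5 < m)%N ->
  (#|[set x | small_pattern m (coset_index x)]|
     < #|[set x | large_pattern m (coset_index x)]|)%N.
Proof.
move=> m5; set S := [set x | small_pattern _ _].
pose g x := if coset_index x == 3 then x + d else x.
have index_g x :
  coset_index (g x) = if coset_index x == 3 then 4 else coset_index x.
  rewrite /g; case: ifP => // /eqP x3.
  by rewrite coset_index_shift /cycle_succ x3 ifT //; lia.
have inj_g : {in S &, injective g}.
  move=> x y; rewrite !inE /small_pattern /= => xS yS gxy.
  have := congr1 coset_index gxy; rewrite !index_g; move: gxy; rewrite /g.
  case: ifP xS => x3; case: ifP yS => y3 // yS xS.
  - by move=> /shift_inj.
  - by move=> _ y4; move: yS; rewrite -y4 !andbF.
  - by move=> _ x4; move: xS; rewrite x4 !andbF.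
rewrite -(card_in_imset inj_g); apply/proper_card/properP; split.
  apply/subsetP => _ /imsetP[x xS ->]; move: xS; rewrite !inE index_g.
  rewrite /small_pattern /large_pattern /=; case: ifP => x3 /=; lia.
have [|x x2] := @coset_index_surj 2; first by lia.
exists x; first by rewrite inE x2 /large_pattern /=; lia.
apply/imsetP => -[y yS xE]; move: yS; rewrite inE.
have := congr1 coset_index xE; rewrite index_g x2 /small_pattern /=.
by case: ifP => // _ <-; rewrite andbF.
Qed.

Lemma index_stable_pair (a : G) : d != 0 ->
  index_stable [set a; a + d] = (m \in [:: 2; 3; 4; 5; 7]%N).
Proof.
move=> d0; have A0 : [set a; a + d] != set0.
  by apply/set0Pn; exists a; rewrite set21.
have m1 : (1 < m)%N by rewrite order_gt1 FinRing.zmod1gE.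
apply/(index_stableP A0)/idP => [stab|m_small B C sB sC]; last first.
  apply/eqP; rewrite -(eqn_pmul2r (order_gt0 d)) -/m.
  by rewrite (card_subfactor_pair m_small sB) (card_subfactor_pair m_small sC).
apply: contraT => m_large.
have [m5 m7] : (5 < m)%N /\ m != 7.
  by move: m_large; rewrite !inE; split; lia.
have := card_small_pattern m5.
by rewrite (stab _ _ (subfactor_of_pattern a d0 (small_pattern_maximal m5 m7))
   (subfactor_of_pattern a d0 (large_pattern_maximal m5))) ltnn.
Qed.

End PairSubfactors.

(** * Counting the index stable pairs *)

(** Both sides count the pairs [(A, a)] with [a] in [A]: for fixed [a], sending [d] to [{a, a + d}]
    is a bijection from the nonzero [d] to the 2-element sets containing [a]. *)
Lemma double_card_pairs (G : finZmodType) (P : pred {set G}) :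
  (#|[set A : {set G} | (#|A| == 2) && P A]| * 2
     = \sum_(a : G) #|[set d : G | (d != 0%R) && P [set a; a + d]%R]|)%N.
Proof.
set S := [set A | _].
transitivity (\sum_(A in S) \sum_(x in A) 1)%N.
  rewrite -sum_nat_const; apply: eq_bigr => A.
  by rewrite inE sum1_card => /andP[/eqP->].
rewrite (exchange_big_dep predT) //=; apply: eq_bigr => a _.
rewrite sum1_card.
rewrite -(card_in_imset (f := fun d => [set a; a + d])); last first.
  move=> d e; rewrite !inE => /andP[d0 _] /andP[e0 _] eq_de.
  have : a + d \in [set a; a + e] by rewrite -eq_de set22.
  by rewrite !inE addrC -subr_eq0 addrK (negbTE d0) addrC => /eqP/addrI.
apply: eq_card => A; rewrite unfold_in inE; apply/andP/imsetP.
  case=> /andP[/cards2P[x [y [xy ->]]] PA].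
  rewrite !inE => /orP[] /eqP aE.
    exists (y - x); rewrite ?inE aE subrKC ?PA ?andbT //.
    by rewrite subr_eq0 eq_sym.
  exists (x - y); rewrite ?inE aE subrKC setUC ?PA ?andbT //.
  by rewrite subr_eq0.
case=> d; rewrite !inE => /andP[d0 PA] ->; rewrite PA set21 cards2.
by rewrite -subr_eq0 opprD addNKr oppr_eq0 d0.
Qed.

(** For [m] dividing the order of [G], the elements of order [m] are the generators of the unique
    subgroup of order [m]. *)
Lemma card_order_cyclic (gT : finGroupType) (G : {group gT}) (m : nat) :
  cyclic G ->
  #|[set x in G | #[x]%g == m]| = if (m %| #|G|)%N then totient m else 0%N.
Proof.
case/cyclicP=> a ->; rewrite -orderE; case: ifP => [mG|/negbT mG]; last first.
  apply/eqP; rewrite cards_eq0; apply/eqP/setP => x; rewrite !inE.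
  apply/negP => /andP[xa /eqP xm]; case/negP: mG.
  by rewrite -xm order_dvdG.
have := cycle_sub_group mG; set b := (a ^+ _)%g => subG.
have bm : #[b]%g = m.
  apply/eqP; have: <[b]>%G \in [set <[b]>%G] by rewrite set11.
  by rewrite -subG inE => /andP[].
rewrite -[in RHS]bm totient_gen; apply: eq_card => x; rewrite !inE /generator.
apply/andP/eqP => [[xa xm]|bx].
  have: <[x]>%G \in [set H : {group gT} | (H \subset <[a]>) && (#|H| == m)]%g.
    by rewrite inE cycle_subG xa.
  by rewrite subG => /set1P/(congr1 val).
have: <[b]>%G \in [set <[b]>%G] by rewrite set11.
rewrite -subG inE /= bx => /andP[xa xm]; split=> //.
by rewrite -cycle_subG.
Qed.

Lemma count_index_stable_pairs (n : nat) :
  (#|[set A : {set 'I_n.+1} | (#|A| == 2) && index_stable A]| * 2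
     = \sum_(m <- [:: 2; 3; 4; 5; 7] | m %| n.+1) n.+1 * totient m)%N.
Proof.
rewrite (double_card_pairs (@index_stable 'I_n.+1)).
pose D := [set d : 'I_n.+1 | #[d]%g \in [:: 2; 3; 4; 5; 7]%N].
transitivity (\sum_(a : 'I_n.+1) #|D|)%N.
  apply: eq_bigr => a _; apply: eq_card => d; rewrite !inE.
  have [->|d0] /= := eqVneq d 0; last by rewrite index_stable_pair ?inE.
  (* The element 0 has order 1, which is not in the list. *)
  by rewrite -(FinRing.zmod1gE 'I_n.+1) order1.
rewrite sum_nat_const card_ord -big_distrr /=; congr (_ * _)%N.
rewrite -sum1_card big_mkcond [RHS]big_mkcond /=.
have cnt m : (if m %| n.+1 then totient m else 0)%N
    = (\sum_(d : 'I_n.+1) (#[d]%g == m))%N.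
  have cycI : cyclic [set: 'I_n.+1].
    by apply/cyclicP; exists Zp1; exact: Zp_cycle.
  have := card_order_cyclic m cycI; rewrite cardsT card_ord => <-.
  rewrite -sum1_card big_mkcond /=; apply: eq_bigr => d _.
  by rewrite !inE; case: eqP.
under [RHS]eq_bigr do rewrite cnt.
rewrite exchange_big; apply: eq_bigr => d _.
rewrite !big_cons big_nil in_set !inE.
(* The list has no repetition, so an order matches at most one entry, and none from 8 on. *)
by move: #[d]%g => [|[|[|[|[|[|[|[|k]]]]]]]].
Qed.

(* The modulus is the positive integer n.+1; 'I_n.+1 carries addition modulo n.+1. *)
Theorem corollary2p9 (n : nat) :
  (#|[set A : {set 'I_n.+1} | (#|A| == 2%N) && index_stable A]|%:R
     = \sum_(m <- [:: 2; 3; 4; 5; 7]%N | (m %| n.+1)%N)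
         (n.+1%:R * (totient m)%:R / 2) :> rat)
  /\
  (\sum_(m <- [:: 2; 3; 4; 5; 7]%N | (m %| n.+1)%N)
         (n.+1%:R * (totient m)%:R / 2)
     = n.+1%:R / 2 *
       ((2 %| n.+1)%N%:R + 2 * (3 %| n.+1)%N%:R + 2 * (4 %| n.+1)%N%:R
        + 4 * (5 %| n.+1)%N%:R + 6 * (7 %| n.+1)%N%:R) :> rat).
Proof.
split; last first.
  rewrite big_mkcond !big_cons big_nil /=.
  (* The only composite entry is 4, treated as the prime power [2 ^ 2]. *)
  rewrite (@totient_pfactor 2 2) // !totient_prime //=.
  by do 5![case: (_ %| _)%N] => /=; field.
rewrite -mulr_suml; apply: (canRL (mulfK _)) => //.
rewrite -natrM count_index_stable_pairs natr_sum.
by under eq_bigr do rewrite natrM.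
Qed.
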